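(* There exists a group homomorphism $\tau:\mathrm{SL}(2,\mathbf Z)\to\mathcal A^\times$ with the following properties. (a) Letting $E_i$ be the subspace of $E$ spanned by $e_1,\dots,e_{2i}$ ($i\ge0$), the chain $0=E_0\subset E_1\subset E_2\subset\cdots$ is a filtration by $\mathbf C\,\mathrm{SL}(2,\mathbf Z)$-submodules (with $Y$ acting by $\tau(Y)$), and for each $i\in\mathbf N$ the quotient $E_i/E_{i-1}$ is isomorphic to the standard $2$-dimensional $\mathbf C\,\mathrm{SL}(2,\mathbf Z)$-module. (b) $\tau(T)=J_\infty$. (c) $\tau(Y)$ is an integer matrix for every $Y\in\mathrm{SL}(2,\mathbf Z)$. (d) There is a constant $C$ such that $|\tau(S)_{i,j}|\le 2^{Cj}$ for all $i,j\in\mathbf N$.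
   Context: $\mathbf N=\{1,2,\dots\}$. $E$ is the complex vector space with basis $\{e_n\}_{n\in\mathbf N}$; $\mathcal A$ is the ring of $\mathbf N\times\mathbf N$ complex matrices with finitely many nonzero entries in each column, acting on $E$ on the left in this basis. $S=\begin{pmatrix}0&-1\\1&0\end{pmatrix}$, $T=\begin{pmatrix}1&1\\0&1\end{pmatrix}$. $J_\infty$ is the matrix with $(J_\infty)_{i,j}=1$ if $j=i$ or $j=i+1$, and $0$ otherwise. *)

(* Defs.v *)
From mathcomp Require Import all_boot all_algebra.
From mathcomp Require Import complex.
From mathcomp Require Import reals Rstruct exp.
Set Implicit Arguments. Unset Strict Implicit. Unset Printing Implicit Defensive.
Import GRing.Theory Num.Theory.
Local Open Scope ring_scope.

Definition RR := Rdefinitions.R.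
Definition CC : numClosedFieldType := complex RR.
Definition absC (z : CC) : RR := Normc.normc z.

(* N x N complex matrices; index n : nat (0-based) stands for the paper's
   basis vector e_(n+1).  M i j is the (i+1, j+1) entry. *)
Definition NNmat := nat -> nat -> CC.

Definition col_finite (M : NNmat) : Prop :=
  forall j, exists b : nat, forall i, (b <= i)%N -> M i j = 0.

(* P is the product M N in A (the sum over k is finite because the columns
   of N have finite support) *)
Definition is_mulA (M N P : NNmat) : Prop :=
  forall j, exists b : nat, (forall k, (b <= k)%N -> N k j = 0) /\
    forall i, P i j = \sum_(k < b) M i k * N k j.

Definition idA : NNmat := fun i j => if i == j then 1 else 0.

Definition unitA (M : NNmat) : Prop :=
  col_finite M /\ exists N : NNmat, col_finite N /\ is_mulA M N idA /\ is_mulA N M idA.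

Definition inSL2Z (Y : 'M[int]_2) : Prop := \det Y = 1.

Definition S_mat : 'M[int]_2 :=
  \matrix_(i < 2, j < 2)
    (if (i == 0 :> nat) && (j == 1 :> nat) then -1
     else if (i == 1 :> nat) && (j == 0 :> nat) then 1 else 0).

Definition T_mat : 'M[int]_2 :=
  \matrix_(i < 2, j < 2) (if (i == 1 :> nat) && (j == 0 :> nat) then 0 else 1).

Definition J_inf : NNmat := fun i j => if (j == i) || (j == i.+1) then 1 else 0.

Definition toC2 (Y : 'M[int]_2) : 'M[CC]_2 := map_mx (fun z : int => z%:~R) Y.

(* the diagonal 2x2 block of M on the basis vectors e_(2i+1), e_(2i+2) (paper
   indexing), i.e. the matrix of the action on E_(i+1)/E_i *)
Definition block2 (M : NNmat) (i : nat) : 'M[CC]_2 :=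
  \matrix_(a < 2, b < 2) M (2 * i + a)%N (2 * i + b)%N.

(* Main.v *)
From HB Require Import structures.
Require Import Defs.
From mathcomp Require Import all_boot all_order all_algebra.
From mathcomp Require Import complex.
From mathcomp Require Import reals Rstruct exp.
From mathcomp Require Import zify ring lra.
From Stdlib Require Import FunctionalExtensionality.
Set Implicit Arguments. Unset Strict Implicit. Unset Printing Implicit Defensive.
Import Order.TTheory GRing.Theory Num.Theory.
Local Open Scope ring_scope.

(** SL(2,Z) is presented by S, T with S^4 = 1 and TSTST = S, so it suffices to
    find an operator s with s^2 = -1 and tst = t + s, where t = 1 + N is the
    Jordan block acting on integral polynomials: e_{j+1} is 'X^j, and N removes
    the constant coefficient and divides by 'X.

    The relation tst = t + s is equivalent to N s = 1 - s N t^-1.  It determines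
    s v up to its constant coefficient, which can be chosen freely, and makes s
    commute with x = t + t^-1 - 2 = N^2 t^-1 and s^2 commute with N.  Hence
    s^2 = -1 only has to be checked on constant coefficients.  Let q be the
    power series with q = x q^2 - 1 and choose (s v)_0 = (q v)_1 = (N q v)_0;
    then (s^2 v)_0 = (N q s v)_0 = (N s q v)_0 = (q v)_0 - (s N t^-1 q v)_0
    = (q v - x q^2 v)_0 = - v_0.

    With weights 4^j the operator x has norm at most 1/8, so the equation for q
    bounds q by 2, which gives the exponential bound on the entries of s. *)

(** * The presentation of SL(2,Z) *)

(* Unlike [divz], this is invariant under (a, c) |-> (- a, - c). *)
Definition floorz (a c : int) : int :=
  if c < 0 then (- a %/ - c)%Z else (a %/ c)%Z.

(** The remainder takes the sign of [c] and is smaller in absolute value, which makes the Euclidean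
    recursions terminate. *)
Lemma floorz_bound (a c : int) : c != 0 ->
  if c < 0 then c < a - floorz a c * c <= 0 else 0 <= a - floorz a c * c < c.
Proof.
move=> c0; rewrite /floorz; case cs: (c < 0).
  have e := divz_eq (- a) (- c); have g : 0 <= ((- a) %% (- c))%Z.
    by apply: modz_ge0; rewrite oppr_eq0.
  have l : ((- a) %% (- c))%Z < - c by apply: ltz_pmod; lia.
  move: e g l; move: (_ %/ _)%Z (_ %% _)%Z => q r; lia.
have e := divz_eq a c; have g := modz_ge0 a c0.
have l : (a %% c)%Z < c by apply: ltz_pmod; lia.
move: e g l; move: (_ %/ _)%Z (_ %% _)%Z => q r; lia.
Qed.

Lemma floorz_uniq (a c q : int) : c != 0 ->
  (if c < 0 then c < a - q * c <= 0 else 0 <= a - q * c < c) -> floorz a c = q.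
Proof.
move=> c0; have := floorz_bound a c0; move: (floorz a c) => p.
case: ifP => cs /andP[h1 h2] /andP[h3 h4]; nia.
Qed.

Lemma mulz_eq1 (a d : int) : a * d = 1 -> a = 1 /\ d = 1 \/ a = -1 /\ d = -1.
Proof.
move=> ad; have /eqP := congr1 absz ad; rewrite abszM muln_eq1 => /andP[].
by move: a d ad => [[|[|?]]|[|?]] [[|[|?]]|[|?]] //; auto.
Qed.

Definition iterz (V : Type) (t t' : V -> V) (q : int) : V -> V :=
  match q with Posz n => iter n t | Negz n => iter n.+1 t' end.

Lemma iterzS (V : Type) (t t' : V -> V) (q : int) (v : V) :
  cancel t' t -> iterz t t' (q + 1) v = t (iterz t t' q v).
Proof.
move=> tK; case: q => n; first by have -> : Posz n + 1 = Posz n.+1 :> int by lia.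
case: n => [|n]; first by rewrite /= tK.
by have -> : Negz n.+1 + 1 = Negz n :> int; [lia | rewrite /= tK].
Qed.

(** * Words in S and T from the Euclidean algorithm *)

Section Presentation.
Context (V : Type) (s t : V -> V).
Hypotheses (s4 : forall v, s (s (s (s v))) = v)
  (tst : forall v, t (s (t (s (t v)))) = s v).

(** A right inverse of [t]: by [tst], composing with [t] on the left gives s s^3 = 1. *)
Let t' v := s (t (s (t (s (s (s v)))))).

Let t'K : cancel t' t.
Proof. by move=> v; rewrite /t' tst s4. Qed.

(** The word t s t s t s t, read in two ways, gives s s t = t s s. *)
Let sst v : s (s (t v)) = t (s (s v)).
Proof.
have sI u w : s u = s w -> u = w by move=> /(congr1 (s \o s \o s)) /=; rewrite !s4.
by apply: sI; rewrite -(tst (s (t v))) (tst v).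
Qed.

Let tt' := iterz t t'.

(* The Euclidean algorithm on the first column writes (a, b; c, d) as a word in
   S and T. *)
Let word0 (a b : int) (v : V) : V :=
  if a == 1 then tt' b v else s (s (tt' (- b) v)).

(** With q = [floorz a c], this encodes Y = T^q S Y', where Y' has rows (c, d) and q (c, d) - (a,
    b). *)
Let step (w : int -> int -> int -> int -> V -> V) (a b c d : int) (v : V) : V :=
  if c == 0 then word0 a b v
  else tt' (floorz a c)
         (s (w c d (floorz a c * c - a) (floorz a c * d - b) v)).

(** Each step lowers |c|, so fuel |c| + 1 reaches the case c = 0 before the default [id]. *)
Let word (a b c d : int) : V -> V :=
  iter `|c|.+1 step (fun _ _ _ _ => id) a b c d.

Let word_fuel (m n : nat) (a b c d : int) : (`|c| < m)%N -> (`|c| < n)%N ->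
  iter m step (fun _ _ _ _ => id) a b c d
  = iter n step (fun _ _ _ _ => id) a b c d.
Proof.
elim: m n a b c d => // m IH [//|n] a b c d cm cn.
apply: functional_extensionality => v /=; rewrite /step.
case: eqP => // /eqP c0; have := floorz_bound a c0.
move: (floorz a c) => q h; rewrite (IH n) //; move: h; case: (c < 0); lia.
Qed.

Let wordE (a b c d : int) : word a b c d = step word a b c d.
Proof.
apply: functional_extensionality => v; rewrite {1}/word iterS /step.
case: eqP => // /eqP c0; have := floorz_bound a c0.
move: (floorz a c) => q h; congr (tt' _ (s (_ v))); apply: word_fuel => //.
by move: h; case: (c < 0); lia.
Qed.

(** Adding the second row to the first raises the quotient by 1 and keeps Y'. For c = 0 and a = -1,
    [sst] moves s^2 past [t]. *)
Let word_t (a b c d : int) (v : V) : a * d - b * c = 1 ->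
  word (a + c) (b + d) c d v = t (word a b c d v).
Proof.
move=> dt; rewrite !wordE /step; case: eqP => [c0|/eqP c0].
  subst c; rewrite /word0 addr0; case: eqP => [a1|an1].
    have -> : d = 1 by lia.
    by rewrite /tt' iterzS.
  have [[//]|[_ ->]] : a = 1 /\ d = 1 \/ a = -1 /\ d = -1.
    by apply: mulz_eq1; rewrite mulr0 subr0 in dt.
  rewrite -sst /tt' -iterzS //; congr (s (s (iterz _ _ _ _))); ring.
have -> : floorz (a + c) c = floorz a c + 1.
  apply: floorz_uniq => //; have := floorz_bound a c0.
  by have -> : a + c - (floorz a c + 1) * c = a - floorz a c * c by ring.
rewrite /= /tt' iterzS //; congr (t (iterz _ _ _ (s (word _ _ _ _ _)))); ring.
Qed.

(** Since [floorz] agrees on (a, c) and (- a, - c), both words take the same steps, and s^2 commutes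
    with the powers of [t]. *)
Let word_opp (a b c d : int) (v : V) : a * d - b * c = 1 ->
  word (- a) (- b) (- c) (- d) v = s (s (word a b c d v)).
Proof.
move: {2}`|c|%N (leqnn `|c|) => n; elim: n a b c d => [|n IH] a b c d cn dt.
  have c0 : c = 0 by lia.
  rewrite c0 oppr0 !wordE /step eqxx /word0.
  have [[-> _]|[-> _]] : (a = 1 /\ d = 1) \/ (a = -1 /\ d = -1).
    by apply: mulz_eq1; rewrite c0 mulr0 subr0 in dt.
    by have -> : (-1 == 1 :> int) = false by []; rewrite eqxx opprK.
  by rewrite opprK eqxx s4.
rewrite !wordE /step oppr_eq0; case: eqP => [c0|/eqP c0].
  by subst c; have := IH a b 0 d isT dt; rewrite !wordE /step oppr0 eqxx.
have bd := floorz_bound a c0.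
have -> : floorz (- a) (- c) = floorz a c.
  by apply: floorz_uniq; rewrite ?oppr_eq0 //; move: bd; case h1: (c < 0); case h2: (- c < 0); lia.
rewrite /=; set q := floorz a c in bd *.
have -> : q * - c - - a = - (q * c - a) by ring.
have -> : q * - d - - b = - (q * d - b) by ring.
rewrite IH; last 2 first.
- by move: bd; case: (c < 0); lia.
- by rewrite -dt; ring.
have ssz u k : tt' k (s (s u)) = s (s (tt' k u)).
  have sst' w : t' (s (s w)) = s (s (t' w)) by rewrite /t' !sst.
  by case: k => m; rewrite /tt' /=; elim: m => [|m IHm] /=; rewrite ?IHm -?sst' -?sst.
by rewrite -ssz.
Qed.

(** With quotient 0 the word of Y is [s] applied to that of - S Y; [word_opp] absorbs the resulting
    s^2. *)
Let word_s0 (a b c d : int) (v : V) : a * d - b * c = 1 -> c != 0 ->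
  floorz a c = 0 -> word (- c) (- d) a b v = s (word a b c d v).
Proof.
move=> dt c0 fl; rewrite [in RHS]wordE /step (negPf c0) fl /= !mul0r !sub0r.
rewrite -word_opp; last by rewrite -dt; ring.
by rewrite !opprK.
Qed.

(** This and [word_sN] deduce the claim for Y from that for S Y, respectively - Y, so that the first
    column can be moved to a convenient range. *)
Let word_sK (a b c d : int) (v : V) : a * d - b * c = 1 ->
  word (- a) (- b) (- c) (- d) v = s (word (- c) (- d) a b v) ->
  word (- c) (- d) a b v = s (word a b c d v).
Proof.
move=> dt; rewrite word_opp // => /(congr1 (s \o s \o s)) /=.
by rewrite !s4.
Qed.

Let word_sN (a b c d : int) (v : V) : a * d - b * c = 1 ->
  word c d (- a) (- b) v = s (word (- a) (- b) (- c) (- d) v) ->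
  word (- c) (- d) a b v = s (word a b c d v).
Proof.
move=> dt; rewrite [in RHS]word_opp //.
rewrite -{1}(opprK c) -{1}(opprK d) word_opp => [/(congr1 (s \o s)) /=|].
  by rewrite !s4.
by rewrite -dt; ring.
Qed.

Let word_s (a b c d : int) (v : V) : a * d - b * c = 1 ->
  word (- c) (- d) a b v = s (word a b c d v).
Proof.
move: {2}(`|a| + `|c|)%N (leqnn (`|a| + `|c|)) => n.
elim: n a b c d => [|n IH] a b c d mn dt.
  have [a0 c0] : a = 0 /\ c = 0 by lia.
  by move: dt; rewrite a0 c0 mul0r mulr0.
(* TSTST = S reduces the claim for Y to the claims for TY and TSTY, and the
   latter has a smaller first column when - c <= a < 0. *)
have neg a' b' c' d' : (`|a'| + `|c'| <= n.+1)%N -> a' * d' - b' * c' = 1 ->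
    0 < c' -> - c' <= a' < 0 -> word (- c') (- d') a' b' v = s (word a' b' c' d' v).
  move=> {}mn {}dt cp /andP[ac a0].
  have dt1 : (a' + c') * d' - (b' + d') * c' = 1 by rewrite -dt; ring.
  have e1 : word (- c') (- d') (a' + c') (b' + d') v = s (word (a' + c') (b' + d') c' d' v).
    apply: word_s0 => //; first by lia.
    by apply: floorz_uniq; [lia | case h: (c' < 0); lia].
  have dt2 : (- c') * (b' + d') - (- d') * (a' + c') = 1 by rewrite -dt; ring.
  have e2 : word a' b' (a' + c') (b' + d') v
      = t (word (- c') (- d') (a' + c') (b' + d') v).
    by rewrite -(word_t v dt2); congr (word _ _ _ _ v); ring.
  have dt3 : a' * (b' + d') - b' * (a' + c') = 1 by rewrite -dt; ring.
  have e3 := IH a' b' (a' + c') (b' + d') _ dt3; rewrite e2 e1 word_t // in e3.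
  have dt4 : - (a' + c') * b' - - (b' + d') * a' = 1 by rewrite -dt; ring.
  have := word_t v dt4; rewrite e3; last by lia.
  by rewrite tst => <-; congr (word _ _ _ _ v); ring.
have flpos a' c' : 0 <= a' < c' -> floorz a' c' = 0.
  by move=> h; apply: floorz_uniq; [lia | case h': (c' < 0); lia].
(* For 0 < c, the cases a < - c and c <= a pass to - S Y and S Y; the others fall under [neg] or
   have quotient 0. *)
have pos a' b' c' d' : (`|a'| + `|c'| <= n.+1)%N -> a' * d' - b' * c' = 1 ->
    0 < c' -> word (- c') (- d') a' b' v = s (word a' b' c' d' v).
  move=> {}mn {}dt cp.
  have dt' : - c' * b' - - d' * a' = 1 by rewrite -dt; ring.
  case: (ltrP a' (- c')) => h1.
    apply: word_sK => //; apply: word_sN => //.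
    have := @word_s0 c' d' (- a') (- b') v; rewrite !opprK; apply.
    - by rewrite -dt; ring.
    - lia.
    - by apply: flpos; lia.
  case: (ltrP a' 0) => h2; first by apply: neg => //; lia.
  case: (ltrP a' c') => h3; first by apply: word_s0; rewrite ?flpos //; lia.
  by apply: word_sK => //; apply: neg => //; lia.
case: (ltrgt0P c) => cs; last 1 first.
- have a0 : a != 0 by apply/eqP => a0; move: dt; rewrite cs a0; lia.
  apply: word_sK => //; apply: word_s0 => //; first by rewrite -dt; ring.
  by rewrite cs oppr0; apply: floorz_uniq => //; case h : (a < 0); lia.
- exact: pos.
apply: word_sN => //.
by have := @pos (- a) (- b) (- c) (- d); rewrite !opprK; apply; rewrite ?mulrNN ?oppr_gt0 // !abszN.
Qed.

Lemma SL2Z_word : exists w : int -> int -> int -> int -> V -> V,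
  [/\ w 1 0 0 1 = id,
      forall a b c d v, a * d - b * c = 1 -> w (- c) (- d) a b v = s (w a b c d v) &
      forall a b c d v, a * d - b * c = 1 -> w (a + c) (b + d) c d v = t (w a b c d v)].
Proof. by exists word; split. Qed.

End Presentation.

(** * Integer matrices and generation of SL(2,Z) by S and T *)

Definition mx2 (a b c d : int) : 'M[int]_2 :=
  \matrix_(i < 2, j < 2) if i == 0 :> nat then if j == 0 :> nat then a else b
                         else if j == 0 :> nat then c else d.

Lemma mx2_eta (Y : 'M[int]_2) : Y = mx2 (Y 0 0) (Y 0 1) (Y 1 0) (Y 1 1).
Proof.
by apply/matrixP => -[[|[|//]] ?] [[|[|//]] ?]; rewrite mxE /=; congr (Y _ _);
  apply: val_inj.
Qed.

Lemma S_mulmx (a b c d : int) : S_mat *m mx2 a b c d = mx2 (- c) (- d) a b.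
Proof.
by apply/matrixP => -[[|[|//]] ?] [[|[|//]] ?];
  rewrite !mxE !big_ord_recl big_ord0 !mxE /=; ring.
Qed.

Lemma T_mulmx (a b c d : int) : T_mat *m mx2 a b c d = mx2 (a + c) (b + d) c d.
Proof.
by apply/matrixP => -[[|[|//]] ?] [[|[|//]] ?];
  rewrite !mxE !big_ord_recl big_ord0 !mxE /=; ring.
Qed.

Lemma det2 (Y : 'M[int]_2) : \det Y = Y 0 0 * Y 1 1 - Y 0 1 * Y 1 0.
Proof.
rewrite [in LHS](mx2_eta Y) (expand_det_row _ ord0) !big_ord_recl big_ord0.
by rewrite /cofactor !det_mx11 !mxE /=; ring.
Qed.

Lemma inSL2Z_mx2 (a b c d : int) : inSL2Z (mx2 a b c d) <-> a * d - b * c = 1.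
Proof. by rewrite /inSL2Z det2 !mxE. Qed.

Lemma inSL2Z_S : inSL2Z S_mat.
Proof. by rewrite /inSL2Z det2 !mxE. Qed.

Lemma inSL2Z_T : inSL2Z T_mat.
Proof. by rewrite /inSL2Z det2 !mxE. Qed.

Lemma inSL2Z1 : inSL2Z 1%:M.
Proof. exact: det1. Qed.

Lemma inSL2Z_mul (X Y : 'M[int]_2) : inSL2Z X -> inSL2Z Y -> inSL2Z (X *m Y).
Proof. by rewrite /inSL2Z det_mulmx => -> ->; rewrite mulr1. Qed.

(** The Euclidean algorithm on the first column, with S and T as monoid generators: T^-1 = S T S T
    S^3. *)
Lemma SL2Z_ind (P : 'M[int]_2 -> Prop) :
  P 1%:M ->
  (forall Y, inSL2Z Y -> P Y -> P (S_mat *m Y)) ->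
  (forall Y, inSL2Z Y -> P Y -> P (T_mat *m Y)) ->
  forall Y, inSL2Z Y -> P Y.
Proof.
move=> P1 PS PT Y; rewrite (mx2_eta Y) inSL2Z_mx2.
move: (Y 0 0) (Y 0 1) (Y 1 0) (Y 1 1) => {Y} a b c d.
pose Q (a b c d : int) := a * d - b * c = 1 /\ P (mx2 a b c d).
have QS a' b' c' d' : Q a' b' c' d' -> Q (- c') (- d') a' b'.
  move=> [dt Pq]; split; first by rewrite -dt; ring.
  by rewrite -S_mulmx; apply: PS; rewrite // inSL2Z_mx2.
have QT a' b' c' d' : Q a' b' c' d' -> Q (a' + c') (b' + d') c' d'.
  move=> [dt Pq]; split; first by rewrite -dt; ring.
  by rewrite -T_mulmx; apply: PT; rewrite // inSL2Z_mx2.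
have QTV a' b' c' d' : Q a' b' c' d' -> Q (a' - c') (b' - d') c' d'.
  move=> /QS/QS/QS/QT/QS/QT/QS; rewrite !opprK.
  by rewrite !opprB !subrKC.
have QTz k a' b' c' d' : Q a' b' c' d' -> Q (a' + k * c') (b' + k * d') c' d'.
  move=> q0; elim/int_rect: k => [|k IH|k IH]; first by rewrite !mul0r !addr0.
    have -> : k.+1%:Z = k%:Z + 1 by lia.
    by rewrite !mulrDl !mul1r !addrA; apply: QT.
  rewrite (_ : - k.+1%:Z = - k%:Z - 1); last by lia.
  by rewrite !mulrBl !mul1r !addrA; apply: QTV.
suff : a * d - b * c = 1 -> Q a b c d by move=> h /h[].
move: {2}`|c|%N (leqnn `|c|) => n; elim: n a b c d => [|n IH] a b c d cn dt.
  have c0 : c = 0 by lia.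
  have Q1 : Q 1 0 0 1.
    by split=> //; congr (P _): P1; apply/matrixP => -[[|[|//]] ?] [[|[|//]] ?]; rewrite !mxE.
  rewrite c0 mulr0 subr0 in dt *.
  case: (mulz_eq1 dt) => -[-> ->].
    by have := QTz b _ _ _ _ Q1; rewrite mulr0 mulr1 addr0 add0r.
  by have /QS/QS := QTz (- b) _ _ _ _ Q1; rewrite mulr0 mulr1 addr0 add0r opprK oppr0.
have [c0|c0] := eqVneq c 0; first by apply: IH => //; rewrite c0.
have := floorz_bound a c0; move: (floorz a c) => q bd.
have /QS/(QTz q) : Q c d (q * c - a) (q * d - b).
  apply: IH; last by rewrite -dt; ring.
  by move: bd; case: (c < 0); lia.
by rewrite !opprB !subrK.
Qed.

(** The Euclidean word is a function of the matrix, so [F] is well defined; it is multiplicative by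
    induction on the left factor. *)
Theorem SL2Z_presentation (V : Type) (s t : V -> V) :
  (forall v, s (s (s (s v))) = v) ->
  (forall v, t (s (t (s (t v)))) = s v) ->
  exists F : 'M[int]_2 -> V -> V,
    [/\ F 1%:M = id, F S_mat = s, F T_mat = t &
        forall X Y, inSL2Z X -> inSL2Z Y -> F (X *m Y) = F X \o F Y].
Proof.
move=> s4 tst.
have [w [w1 ws wt]] := SL2Z_word s4 tst.
pose F (Y : 'M[int]_2) := w (Y 0 0) (Y 0 1) (Y 1 0) (Y 1 1).
have FS Y : inSL2Z Y -> F (S_mat *m Y) = s \o F Y.
  rewrite (mx2_eta Y) inSL2Z_mx2 S_mulmx /F !mxE /= => dt.
  by apply: functional_extensionality => v; rewrite ws.
have FT Y : inSL2Z Y -> F (T_mat *m Y) = t \o F Y.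
  rewrite (mx2_eta Y) inSL2Z_mx2 T_mulmx /F !mxE /= => dt.
  by apply: functional_extensionality => v; rewrite wt.
have F1 : F 1%:M = id by rewrite /F !mxE.
exists F; split=> //.
- by rewrite -[S_mat]mulmx1 FS ?F1 //; apply: inSL2Z1.
- by rewrite -[T_mat]mulmx1 FT ?F1 //; apply: inSL2Z1.
move=> X Y + hY; elim/SL2Z_ind: X / => [|X hX IH|X hX IH].
- by rewrite mul1mx F1.
- by rewrite -mulmxA !FS ?IH //; apply: inSL2Z_mul.
- by rewrite -mulmxA !FT ?IH //; apply: inSL2Z_mul.
Qed.

(** * The operators t, x, q and s *)

Local Notation V := {poly int}.

Implicit Types u v w : V.

(* The solution of [f = Phi f], when [Phi f v] only involves the values of [f] at
   polynomials smaller than [v]. *)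
Definition locfix (Phi : (V -> V) -> V -> V) (v : V) : V :=
  iter (size v) Phi (fun=> 0) v.

(** By locality, n iterations settle the values at polynomials of size at most n. The invariant [J],
    such as a size bound, covers equations where [f] is applied to a value of [f]. *)
Lemma locfixP (Phi : (V -> V) -> V -> V) (J : V -> V -> Prop) :
  (forall v : V, J v 0) ->
  (forall f, (forall v, J v (f v)) -> forall v, J v (Phi f v)) ->
  Phi (fun=> 0) 0 = 0 ->
  (forall n f g, (forall v, J v (f v)) -> (forall v, J v (g v)) ->
    (forall v : V, (size v <= n)%N -> f v = g v) ->
    forall v : V, (size v <= n.+1)%N -> Phi f v = Phi g v) ->
  (forall v, locfix Phi v = Phi (locfix Phi) v) /\ (forall v, J v (locfix Phi v)).
Proof.
move=> J0 JPhi Phi0 loc; pose it n := iter n Phi (fun=> 0).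
have Jit n v : J v (it n v) by elim: n v => [|n IH] v; [exact: J0 | exact: JPhi].
have itS n (v : V) : (size v <= n)%N -> it n.+1 v = it n v.
  elim: n v => [|n IH] v; last exact: (loc n _ _ (Jit _) (Jit _) IH).
  by rewrite size_poly_leq0 => /eqP ->.
have itE m n (v : V) : (size v <= n)%N -> (n <= m)%N -> it m v = it n v.
  move=> vn /subnK <-; elim: (m - n)%N => // k IH.
  by rewrite addSn itS ?IH // (leq_trans vn) ?leq_addl.
split=> v; last exact: Jit.
rewrite {1}/locfix -/(it _ _) -(itE (size v).+1) //.
by apply: (loc (size v)) => // [w|u uv]; [exact: Jit | exact: (itE (size v) (size u))].
Qed.

Lemma locfix0 Phi : locfix Phi 0 = 0.
Proof. by rewrite /locfix size_poly0. Qed.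

(** * The shift N, the unipotent t = 1 + N and operators built from them *)

Definition shift (v : V) : V := drop_poly 1 v.

Lemma shift_is_linear : linear shift.
Proof. exact: linearP. Qed.
HB.instance Definition _ := GRing.isLinear.Build int V V *:%R shift shift_is_linear.

Lemma coef_shift (v : V) i : (shift v)`_i = v`_i.+1.
Proof. by rewrite coef_drop_poly addn1. Qed.

Lemma size_shift (v : V) : size (shift v) = (size v).-1.
Proof. by rewrite size_drop_poly subn1. Qed.

Lemma shift_mulX (v : V) : shift (v * 'X) = v.
Proof. by apply/polyP => i; rewrite coef_shift coefMX. Qed.

Lemma shift_polyC c : shift c%:P = 0.
Proof. by apply/polyP => i; rewrite coef_shift coefC coef0. Qed.

Definition unip (v : V) : V := v + shift v.

Lemma unip_is_linear : linear unip.
Proof. by move=> a u v; rewrite /unip linearP scalerDr addrACA. Qed.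
HB.instance Definition _ := GRing.isLinear.Build int V V *:%R unip unip_is_linear.

Lemma size_ind (P : V -> Prop) : P 0 ->
  (forall n, (forall u : V, (size u <= n)%N -> P u) ->
    forall v : V, (size v <= n.+1)%N -> P v) -> forall v, P v.
Proof.
move=> P0 PS v; move: {2}(size v) (leqnn (size v)) => n.
elim: n v => [|n IH] v; last exact: PS.
by rewrite size_poly_leq0 => /eqP ->.
Qed.

Lemma size_ind2 (P : V -> V -> Prop) : P 0 0 ->
  (forall n, (forall u v : V, (size u <= n)%N -> (size v <= n)%N -> P u v) ->
    forall u v : V, (size u <= n.+1)%N -> (size v <= n.+1)%N -> P u v) -> forall u v, P u v.
Proof.
move=> P0 PS u v; move: (leq_maxl (size u) (size v)) (leq_maxr (size u) (size v)).
move: (maxn _ _) => n; elim: n u v => [|n IH] u v; last exact: PS.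
by rewrite !size_poly_leq0 => /eqP -> /eqP ->.
Qed.

(** The inverse of [unip]: t^-1 = 1 - t^-1 N, a finite Neumann series on each polynomial. *)
Definition unipV : V -> V := locfix (fun f v => v - f (shift v)).

Lemma unipV_fix :
  (forall v, unipV v = v - unipV (shift v)) /\ (forall v, (size (unipV v) <= size v)%N).
Proof.
apply: (@locfixP _ (fun v w => (size w <= size v)%N)).
- by move=> v; rewrite size_poly0.
- move=> f hf v; apply: leq_trans (size_polyD _ _) _.
  by rewrite geq_max leqnn size_polyN (leq_trans (hf _)) // size_shift leq_pred.
- by rewrite subr0.
- by move=> n f g _ _ fg v vn; rewrite fg // size_shift; lia.
Qed.

Definition unipVE := proj1 unipV_fix.
Definition size_unipV := proj2 unipV_fix.

Lemma unipV_is_linear : linear unipV.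
Proof.
move=> a; apply: size_ind2 => [|n IH u v un vn].
  by rewrite scaler0 addr0 /unipV !locfix0 scaler0 addr0.
rewrite [LHS]unipVE [unipV u]unipVE [unipV v]unipVE linearP IH ?size_shift; [|lia|lia].
by rewrite scalerBr opprD addrACA.
Qed.
HB.instance Definition _ := GRing.isLinear.Build int V V *:%R unipV unipV_is_linear.

Lemma unipV_shift v : unipV (shift v) = shift (unipV v).
Proof.
elim/size_ind: v => [|n IH v vn]; first by rewrite !linear0.
rewrite [in RHS]unipVE linearB /= -IH; last by rewrite size_shift; lia.
exact: unipVE.
Qed.

Lemma unipK v : unipV (unip v) = v.
Proof. by rewrite /unip linearD /= [unipV v]unipVE subrK. Qed.

(* [xop] is [T + T^-1 - 2], for [T = unip]. *)
Definition xop (v : V) : V := shift (shift (unipV v)).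

Lemma xop_is_linear : linear xop.
Proof. by move=> a u v; rewrite /xop !linearP. Qed.
HB.instance Definition _ := GRing.isLinear.Build int V V *:%R xop xop_is_linear.

Lemma xopE v : xop v = unip v + unipV v - v *+ 2.
Proof.
have e w : shift (unipV w) = w - unipV w.
  by rewrite -unipV_shift [unipV w]unipVE subKr.
by rewrite /xop e linearB /= e /unip mulr2n; ring.
Qed.

Lemma size_xop v : (size (xop v) <= (size v).-1)%N.
Proof. by rewrite /xop !size_shift; have := size_unipV v; lia. Qed.

(* The power series [q] in [x] with [q = x q ^ 2 - 1], evaluated at [xop]. *)
Definition qop : V -> V := locfix (fun f v => f (f (xop v)) - v).

(** As x lowers the size and [f] does not raise it, both calls of [f] are at smaller polynomials. *)
Lemma qop_fix :
  (forall v, qop v = qop (qop (xop v)) - v) /\ (forall v, (size (qop v) <= size v)%N).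
Proof.
apply: (@locfixP _ (fun v w => (size w <= size v)%N)).
- by move=> v; rewrite size_poly0.
- move=> f hf v; apply: leq_trans (size_polyD _ _) _; rewrite geq_max size_polyN leqnn.
  rewrite (leq_trans (hf _)) // (leq_trans (hf _)) //.
  by rewrite (leq_trans (size_xop _)) ?leq_pred.
- by rewrite subr0.
- move=> n f g hf hg fg v vn; have := size_xop v => xv.
  rewrite (fg (xop v)) ?fg //; last by lia.
  by apply: leq_trans (hg _) _; lia.
Qed.

Definition qopE := proj1 qop_fix.
Definition size_qop := proj2 qop_fix.

Lemma qop_is_linear : linear qop.
Proof.
move=> a; apply: size_ind2 => [|n IH u v un vn].
  by rewrite scaler0 addr0 /qop !locfix0 scaler0 addr0.
have [xu xv] := (size_xop u, size_xop v).
have [qu qv] := (size_qop (xop u), size_qop (xop v)).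
rewrite [LHS]qopE [qop u]qopE [qop v]qopE linearP /= IH ?IH; [|lia..].
by rewrite scalerBr opprD addrACA.
Qed.
HB.instance Definition _ := GRing.isLinear.Build int V V *:%R qop qop_is_linear.

(** Used for the shift, x and s. [B] passes through the equation for q, whose inner calls are at
    smaller polynomials. *)
Lemma qop_comm (B : {linear V -> V}) :
  (forall v, B (xop v) = xop (B v)) -> forall v, B (qop v) = qop (B v).
Proof.
move=> Bx; apply: size_ind => [|n IH v vn]; first by rewrite !linear0.
have xv := size_xop v; have qxv := size_qop (xop v).
by rewrite qopE linearB IH ?IH ?Bx -?qopE //; lia.
Qed.

(** The multiple of ['X] solves N s = 1 - s N t^-1; the last term is the chosen constant
    coefficient. *)
Definition sop : V -> V :=
  locfix (fun f v => (v - f (shift (unipV v))) * 'X + ((qop v)`_1)%:P).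

Lemma sopE v : sop v = (v - sop (shift (unipV v))) * 'X + ((qop v)`_1)%:P.
Proof.
apply: (proj1 (locfixP (J := fun _ _ => True) _ _ _ _)) => //.
- by rewrite subr0 mul0r linear0 coef0 addr0.
- by move=> n f g _ _ fg u un; rewrite fg // size_shift; have := size_unipV u; lia.
Qed.

Lemma sop_is_linear : linear sop.
Proof.
move=> a; apply: size_ind2 => [|n IH u v un vn].
  by rewrite scaler0 addr0 /sop !locfix0 scaler0 addr0.
have [du dv] := (size_unipV u, size_unipV v).
rewrite [LHS]sopE [sop u]sopE [sop v]sopE !linearP /= IH ?size_shift; [|lia..].
rewrite coefD coefZ polyCD polyCM -!mul_polyC; ring.
Qed.
HB.instance Definition _ := GRing.isLinear.Build int V V *:%R sop sop_is_linear.

(** * Relations between s, t, x and q *)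

Lemma shift_sop v : shift (sop v) = v - sop (shift (unipV v)).
Proof. by rewrite [sop v]sopE linearD /= shift_mulX shift_polyC addr0. Qed.

Lemma sop_coef0 v : (sop v)`_0 = (qop v)`_1.
Proof. by rewrite sopE coefD coefMX coefC add0r. Qed.

(** Follows from the equation for N s, because 1 - N t^-1 = t^-1. *)
Lemma unip_sop v : unip (sop v) = v + sop (unipV v).
Proof.
rewrite /unip shift_sop {2}[unipV v]unipVE unipV_shift linearB /=; ring.
Qed.

Lemma unip_sop_unip v : unip (sop (unip v)) = unip v + sop v.
Proof. by rewrite unip_sop unipK. Qed.

Lemma sop_unip v : sop (unip v) = v + unipV (sop v).
Proof. by rewrite -[LHS]unipK unip_sop_unip linearD /= unipK. Qed.

(** Adding s t = 1 + t^-1 s and s t^-1 = t s - 1 cancels the constants. *)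
Lemma sop_xop v : sop (xop v) = xop (sop v).
Proof.
rewrite !xopE linearB linearD linearMn /= sop_unip unip_sop; ring.
Qed.

(** Both sides expand to s + s t^-1 s. *)
Lemma sop_sop_unip v : sop (sop (unip v)) = unip (sop (sop v)).
Proof. by rewrite sop_unip linearD /= unip_sop. Qed.

Lemma sop_sop_shift v : sop (sop (shift v)) = shift (sop (sop v)).
Proof.
by apply: (addrI (sop (sop v))); rewrite -!linearD -/(unip _) /= sop_sop_unip.
Qed.

Lemma xop_shift v : shift (xop v) = xop (shift v).
Proof. by rewrite /xop unipV_shift. Qed.

Lemma sop_sop_coef0 v : (sop (sop v))`_0 = - v`_0.
Proof.
have qshift w : shift (qop w) = qop (shift w) := qop_comm xop_shift w.
have qxop w : xop (qop w) = qop (xop w) by apply: qop_comm.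
have qsop w : sop (qop w) = qop (sop w) := qop_comm sop_xop w.
rewrite sop_coef0 -qsop -coef_shift shift_sop coefB sop_coef0 -coef_shift.
(* The constant coefficient of s N t^-1 q v is that of q x q v = q q x v, and q v - q q x v = -
   v. *)
rewrite qshift -/(xop _) qxop -coefB -coefN; congr (_`_0).
by rewrite [X in X - _]qopE addrAC subrr add0r.
Qed.

Lemma sop_sop v : sop (sop v) = - v.
Proof.
apply/polyP => i; elim: i v => [|i IH] v; first by rewrite sop_sop_coef0 coefN.
by rewrite -coef_shift -sop_sop_shift IH !coefN coef_shift.
Qed.

Lemma coef_sopS v i : (sop v)`_i.+1 = v`_i - (sop (shift (unipV v)))`_i.
Proof. by rewrite -coef_shift shift_sop coefB. Qed.

(** Unfolding twice, (s v)_{j+2} = (t^-1 N v)_{j+1} + (s (N t^-1)^2 v)_j. The argument of the last s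
    is shorter by two, whence the induction in steps of two. *)
Lemma size_sop m v : (size v <= 2 * m)%N -> (size (sop v) <= 2 * m)%N.
Proof.
elim: m v => [|m IH] v vm.
  by move: vm; rewrite size_poly_leq0 => /eqP ->; rewrite linear0 size_poly0.
apply/leq_sizeP => -[|[|j]] jm; try lia.
rewrite !coef_sopS coef_shift; set u := shift (unipV v).
have du := size_unipV v; have ddu := size_unipV u.
have su : size u = (size (unipV v)).-1 by rewrite size_shift.
have dsu := size_unipV (shift v); rewrite size_shift in dsu.
rewrite (nth_default 0 (s := sop _)); last first.
  apply: leq_trans (IH _ _) _; last by lia.
  by rewrite size_shift; lia.
rewrite subr0 [unipV v]unipVE coefB subKr nth_default //.
by apply: leq_trans dsu _; lia.
Qed.

Lemma size_unip v : (size (unip v) <= size v)%N.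
Proof.
apply: leq_trans (size_polyD _ _) _.
by rewrite geq_max leqnn size_shift leq_pred.
Qed.

(** * The weighted norm and the bound on the entries of s *)

Definition wnorm (v : V) : int := \sum_(i < size v) `|v`_i| * 4 ^+ i.

Lemma wnormE n (v : V) : (size v <= n)%N -> wnorm v = \sum_(i < n) `|v`_i| * 4 ^+ i.
Proof.
move=> vn; rewrite /wnorm (big_ord_widen n (fun i => `|v`_i| * 4 ^+ i)) //.
rewrite big_mkcond /=; apply: eq_bigr => i _; case: ltnP => // iv.
by rewrite nth_default // normr0 mul0r.
Qed.

Lemma wnormN v : wnorm (- v) = wnorm v.
Proof.
by rewrite /wnorm size_polyN; apply: eq_bigr => i _; rewrite coefN normrN.
Qed.

Lemma wnormD u v : wnorm (u + v) <= wnorm u + wnorm v.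
Proof.
have un := leq_maxl (size u) (size v); have vn := leq_maxr (size u) (size v).
rewrite (wnormE un) (wnormE vn) (wnormE (size_polyD u v)) -big_split /=.
apply: ler_sum => i _; rewrite -mulrDl coefD ler_wpM2r ?ler_normD //.
by rewrite exprn_ge0.
Qed.

Lemma wnorm_ge0 v : 0 <= wnorm v.
Proof. by apply: sumr_ge0 => i _; rewrite mulr_ge0 ?exprn_ge0. Qed.

Lemma wnorm_shift v : `|v`_0| + 4 * wnorm (shift v) = wnorm v.
Proof.
have vn : (size v <= (size v).+1)%N by [].
rewrite (wnormE vn) big_ord_recl expr0 mulr1; congr (_ + _).
rewrite (@wnormE (size v)) ?size_shift ?leq_pred // mulr_sumr; apply: eq_bigr => i _.
by rewrite coef_shift /= exprS mulrCA mulrA.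
Qed.

Lemma wnorm_shift_le v : 4 * wnorm (shift v) <= wnorm v.
Proof. by rewrite -[leRHS]wnorm_shift lerDr. Qed.

Lemma coef_wnorm v i : `|v`_i| <= wnorm v.
Proof.
elim: i v => [|i IH] v; rewrite -(wnorm_shift v).
  by rewrite lerDl mulr_ge0 ?wnorm_ge0.
rewrite -coef_shift; apply: le_trans (IH _) _.
by have := wnorm_ge0 (shift v); have := normr_ge0 v`_0; lra.
Qed.

Lemma wnormXn n : wnorm 'X^n = 4 ^+ n.
Proof.
rewrite /wnorm size_polyXn big_ord_recr /= coefXn eqxx normr1 mul1r big1 ?add0r //.
by move=> i _; rewrite coefXn ltn_eqF ?ltn_ord // normr0 mul0r.
Qed.

(** The shift has norm at most 1/4, so in t^-1 = 1 - t^-1 N the bound 2 reproduces itself: 1 + 2/4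
    <= 2. *)
Lemma wnorm_unipV v : wnorm (unipV v) <= 2 * wnorm v.
Proof.
elim/size_ind: v => [|n IH v vn]; first by rewrite linear0 /wnorm size_poly0 big_ord0.
have IH' : wnorm (unipV (shift v)) <= 2 * wnorm (shift v).
  by apply: IH; rewrite size_shift; lia.
rewrite unipVE; move: IH'.
have := wnormD v (- unipV (shift v)); rewrite wnormN.
by have := wnorm_shift v; have := wnorm_ge0 (unipV (shift v)); have := normr_ge0 v`_0; lra.
Qed.

Lemma wnorm_xop v : 8 * wnorm (xop v) <= wnorm v.
Proof.
rewrite /xop; have := wnorm_unipV v; have := wnorm_shift (unipV v).
by have := wnorm_shift (shift (unipV v));
  have := normr_ge0 (unipV v)`_0; have := normr_ge0 (shift (unipV v))`_0; lra.
Qed.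

(** Two factors 2 against the norm 1/8 of x keep q q x v below the norm of v. *)
Lemma wnorm_qop v : wnorm (qop v) <= 2 * wnorm v.
Proof.
elim/size_ind: v => [|n IH v vn]; first by rewrite linear0 /wnorm size_poly0 big_ord0.
have xv := size_xop v; have qxv := size_qop (xop v).
have h1 : wnorm (qop (xop v)) <= 2 * wnorm (xop v) by apply: IH; lia.
have h2 : wnorm (qop (qop (xop v))) <= 2 * wnorm (qop (xop v)) by apply: IH; lia.
have h3 : wnorm (qop (qop (xop v))) <= wnorm v.
  apply: le_trans h2 _; apply: le_trans (wnorm_xop v).
  rewrite (_ : 8 = 2 * 4) // -mulrA ler_pM2l //; apply: le_trans h1 _.
  by rewrite ler_wpM2r ?wnorm_ge0.
rewrite qopE; apply: le_trans (wnormD _ _) _; rewrite wnormN.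
by rewrite mulr_natl mulr2n lerD2r.
Qed.

(** Induction on the index: N t^-1 has norm at most 1/2, and 1 + 3/2 <= 3. *)
Lemma coef_sop_le v i : `|(sop v)`_i| <= 3 * wnorm v.
Proof.
elim: i v => [|i IH] v.
  rewrite sop_coef0 -coef_shift; apply: le_trans (coef_wnorm _ _) _.
  have := wnorm_shift (qop v); have := wnorm_qop v; have := wnorm_ge0 v.
  have := normr_ge0 (qop v)`_0; move: (wnorm (shift (qop v))) (wnorm (qop v)) (wnorm v).
  by move=> a b c; lra.
have arith (a b c : int) : 4 * a <= b -> b <= 2 * c -> 0 <= c -> c + 3 * a <= 3 * c by lra.
rewrite coef_sopS; apply: le_trans (ler_normB _ _) _.
apply: le_trans (lerD (coef_wnorm v i) (IH _)) _.
apply: arith (wnorm_ge0 v); [exact: wnorm_shift_le | exact: wnorm_unipV].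
Qed.

(** * The diagonal blocks and the theorem *)

Lemma linear_coef (f : {linear V -> V}) n v i : (size v <= n)%N ->
  (f v)`_i = \sum_(k < n) v`_k * (f 'X^k)`_i.
Proof.
move=> vn; have {1}-> : v = \poly_(k < n) v`_k.
  apply/polyP => k; rewrite coef_poly; case: ltnP => // nk.
  by rewrite nth_default // (leq_trans vn).
rewrite poly_def linear_sum coef_sum; apply: eq_bigr => k _.
by rewrite linearZ coefZ.
Qed.

Definition filtered (f : V -> V) : Prop :=
  forall m v, (size v <= 2 * m)%N -> (size (f v) <= 2 * m)%N.

Definition blk (i : nat) (f : V -> V) : 'M[int]_2 :=
  \matrix_(a < 2, b < 2) (f 'X^(2 * i + b))`_(2 * i + a).

(** Matrices of filtered maps are block upper triangular: in the product, indices below 2i are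
    killed by [f] and those from 2i + 2 on by [g]. *)
Lemma blk_comp i (f g : {linear V -> V}) : filtered f -> filtered g ->
  blk i (f \o g) = blk i f *m blk i g.
Proof.
move=> ff fg; apply/matrixP => a b; rewrite !mxE /=.
have sX (k m : nat) : (k < 2 * m)%N -> (size ('X^k : V) <= 2 * m)%N by rewrite size_polyXn.
have sg : (size (g 'X^(2 * i + b)) <= (2 * i).+2)%N.
  have -> : (2 * i).+2 = (2 * i.+1)%N by lia.
  by apply/fg/sX; have := ltn_ord b; lia.
rewrite (linear_coef _ _ sg) 2!big_ord_recr /= big1 => [|k _]; last first.
  rewrite [X in _ * X]nth_default ?mulr0 //.
  by rewrite (leq_trans (ff i _ _)) ?leq_addr ?sX.
rewrite !big_ord_recl big_ord0 !mxE /= addn0 addn1 add0r addr0.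
by rewrite [X in X + _]mulrC [X in _ + X]mulrC.
Qed.

Lemma filtered_unip : filtered unip.
Proof. by move=> m v vm; apply: leq_trans (size_unip v) vm. Qed.

Lemma filtered_sop : filtered sop.
Proof. exact: size_sop. Qed.

Lemma blk_id i : blk i id = 1%:M.
Proof.
by apply/matrixP => a b; rewrite !mxE coefXn eqn_add2l.
Qed.

Lemma blk_unip i : blk i unip = T_mat.
Proof.
apply/matrixP => a b; rewrite !mxE coefD coef_shift !coefXn -addnS !eqn_add2l.
by case: a b => -[|[|//]] ? [[|[|//]] ?].
Qed.

Lemma mx2_mul a b c d a' b' c' d' : mx2 a b c d *m mx2 a' b' c' d' =
  mx2 (a * a' + b * c') (a * b' + b * d') (c * a' + d * c') (c * b' + d * d').
Proof.
by apply/matrixP => -[[|[|//]] ?] [[|[|//]] ?];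
  rewrite !mxE !big_ord_recl big_ord0 !mxE /= addr0.
Qed.

Lemma T_mx2 : T_mat = mx2 1 1 0 1.
Proof. by apply/matrixP => -[[|[|//]] ?] [[|[|//]] ?]; rewrite !mxE. Qed.

(** The first relation forces lower left entry 1 and trace 0; the second then fixes the upper right
    entry. *)
Lemma TST_SS_mx2 (M : 'M[int]_2) :
  T_mat *m (M *m T_mat) = T_mat + M -> M *m M = - 1%:M ->
  M = mx2 (M 0 0) (- 1 - M 0 0 ^+ 2) 1 (- M 0 0).
Proof.
rewrite (mx2_eta M); move: (M 0 0) (M 0 1) (M 1 0) (M 1 1) => p q r s.
rewrite T_mx2 !mx2_mul => /matrixP eT /matrixP eS.
move: (eT 0 0) (eT 0 1) (eS 0 0); rewrite !mxE /= => e1 e2 e3.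
have r1 : r = 1 by lia.
have sp : s = - p by lia.
rewrite r1 sp; congr (mx2 _ _ _ _).
by move: e3; rewrite r1 expr2; lia.
Qed.

Lemma blk_sop i : let p := blk i sop 0 0 in
  blk i sop = mx2 p (- 1 - p ^+ 2) 1 (- p).
Proof.
have eTST : T_mat *m (blk i sop *m T_mat) = T_mat + blk i sop.
  rewrite -(blk_unip i) -!blk_comp //; try exact: filtered_unip; try exact: filtered_sop.
    by apply/matrixP => a b; rewrite !mxE /= unip_sop_unip coefD.
  by move=> m v vm; apply: filtered_sop; apply: filtered_unip.
have eSS : blk i sop *m blk i sop = - 1%:M.
  rewrite -blk_comp; try exact: filtered_sop.
  by rewrite -(blk_id i); apply/matrixP => a b; rewrite !mxE /= sop_sop coefN.
exact: TST_SS_mx2.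
Qed.

(** For p the upper left entry of the block, P = T^-p conjugates the block to S and commutes with T,
    so one P serves both generators. *)
Lemma blk_conj_sop i (P := mx2 1 (- blk i sop 0 0) 0 1) :
  P *m blk i sop = S_mat *m P.
Proof. by rewrite blk_sop /P S_mulmx mx2_mul; congr mx2; rewrite ?expr2; ring. Qed.

Lemma blk_conj_unip i p : mx2 1 p 0 1 *m blk i unip = T_mat *m mx2 1 p 0 1.
Proof. by rewrite blk_unip T_mulmx {1}T_mx2 mx2_mul; congr mx2; ring. Qed.

Lemma absC_int (z : int) : absC z%:~R = `|z|%:~R.
Proof.
rewrite /absC -(rmorph_int (real_complex RR)) /= expr0n addr0 sqrtr_sqr.
by rewrite intr_norm.
Qed.

Theorem theorem5p1 :
  exists tau : 'M[int]_2 -> NNmat,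
    (* tau is a group homomorphism SL(2,Z) -> A^x *)
    (forall Y, inSL2Z Y -> unitA (tau Y)) /\
    tau 1%:M = idA /\
    (forall X Y, inSL2Z X -> inSL2Z Y -> is_mulA (tau X) (tau Y) (tau (X *m Y))) /\
    (* (a) E_i = span(e_1..e_(2i)) is stable under every tau Y ... *)
    (forall Y, inSL2Z Y -> forall (i j k : nat),
        (j < 2 * i)%N -> (2 * i <= k)%N -> tau Y k j = 0) /\
    (* ... and E_(i+1)/E_i is isomorphic to the standard module C^2 *)
    (forall i : nat, exists P : 'M[CC]_2, P \in unitmx /\
        forall Y, inSL2Z Y -> P *m block2 (tau Y) i = toC2 Y *m P) /\
    (* (b) *)
    tau T_mat = J_inf /\
    (* (c) *)
    (forall Y, inSL2Z Y -> forall i j, exists z : int, tau Y i j = z%:~R) /\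
    (* (d) *)
    (exists C : RR, forall i j : nat,
        absC (tau S_mat i j) <= powR 2 (C * (j.+1)%:R)).
Proof.
have [|v|F [F1 FS FT FM]] := @SL2Z_presentation V sop unip.
- by move=> v; rewrite !sop_sop opprK.
(* By t s t = t + s, t s t s t = t s t + s^2 t = (t + s) - t = s. *)
- by rewrite (unip_sop_unip (sop _)) unip_sop_unip sop_sop addrAC subrr add0r.
(* The presentation acts by bare functions; linearity and the filtration are recovered by induction
   along S and T. *)
have Flin Y : inSL2Z Y -> exists2 g : {linear V -> V}, F Y = g & filtered g.
  elim/SL2Z_ind: Y / => [|Y hY [g FY fg]|Y hY [g FY fg]].
  - by exists idfun.
  - exists (sop \o g); first by rewrite FM ?FS ?FY //; exact: inSL2Z_S.
    by move=> m v vm; apply/filtered_sop/fg.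
  - exists (unip \o g); first by rewrite FM ?FT ?FY //; exact: inSL2Z_T.
    by move=> m v vm; apply/filtered_unip/fg.
(* Column j lists the coefficients of an integer polynomial, hence is finite and integral. *)
pose tau Y : NNmat := fun i j => ((F Y 'X^j)`_i)%:~R.
have tau_mul X Y : inSL2Z X -> inSL2Z Y -> is_mulA (tau X) (tau Y) (tau (X *m Y)).
  move=> hX hY j; exists (size (F Y 'X^j)); split=> [k kb|i].
    by rewrite /tau nth_default.
  have [g gE _] := Flin X hX.
  rewrite /tau FM // gE /= (linear_coef g _ (leqnn _)) rmorph_sum /=.
  by apply: eq_bigr => k _; rewrite rmorphM mulrC.
have tau_col Y : col_finite (tau Y).
  by move=> j; exists (size (F Y 'X^j)) => i ij; rewrite /tau nth_default.
have tau1 : tau 1%:M = idA.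
  apply: functional_extensionality => i; apply: functional_extensionality => j.
  by rewrite /tau F1 coefXn /idA; case: eqP.
exists tau; split; [|split; [exact: tau1|split; [exact: tau_mul|split; [|split; [|split; [|split]]]]]].
- move=> Y hY; split; first exact: tau_col.
  (* In determinant 1 the adjugate is the inverse. *)
  exists (tau (\adj Y)); split; first exact: tau_col.
  have hA : inSL2Z (\adj Y).
    have := congr1 determinant (mul_mx_adj Y).
    by rewrite det_mulmx hY det1 mul1r.
  have := tau_mul _ _ hY hA; have := tau_mul _ _ hA hY.
  by rewrite mul_mx_adj mul_adj_mx hY tau1.
- move=> Y hY i j k ji ik; have [g gE fg] := Flin Y hY.
  by rewrite /tau gE nth_default // (leq_trans _ ik) // fg // size_polyXn.
- move=> i; pose P := mx2 1 (- blk i sop 0 0) 0 1.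
  have detP : \det P = 1 by rewrite det2 !mxE /= mulr0 subr0.
  exists (toC2 P); split.
    by rewrite unitmxE det_map_mx detP rmorph1 unitr1.
  suff blkE Y : inSL2Z Y -> P *m blk i (F Y) = Y *m P.
    move=> Y hY; rewrite -map_mxM -blkE // map_mxM; congr (_ *m _).
    by apply/matrixP => a b; rewrite !mxE.
  elim/SL2Z_ind: Y / => [|Y hY IH|Y hY IH].
  + by rewrite F1 blk_id mulmx1 mul1mx.
  + have [g gE fg] := Flin Y hY; rewrite FM ?FS ?gE; [|exact: inSL2Z_S|by []].
    rewrite blk_comp //; last exact: filtered_sop.
    by rewrite mulmxA blk_conj_sop -mulmxA -gE IH mulmxA.
  + have [g gE fg] := Flin Y hY; rewrite FM ?FT ?gE; [|exact: inSL2Z_T|by []].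
    rewrite blk_comp //; last exact: filtered_unip.
    by rewrite mulmxA blk_conj_unip -mulmxA -gE IH mulmxA.
- apply: functional_extensionality => i; apply: functional_extensionality => j.
  rewrite /tau FT coefD coef_shift !coefXn /J_inf (eq_sym j i) (eq_sym j i.+1).
  by case: (eqVneq i j) => [->|_]; [rewrite (gtn_eqF (ltnSn j)) | case: (i.+1 == j)].
- by move=> Y _ i j; exists (F Y 'X^j)`_i.
(* The bound 3 * 4^j is at most 4^(j+1) = 2^(2(j+1)), where j + 1 is the index of the basis vector
   ['X^j]. *)
- exists 2 => i j; rewrite absC_int FS.
  have -> : powR 2 (2 * j.+1%:R) = (4 ^+ j.+1 : int)%:~R :> RR.
    by rewrite -natrM powR_mulrn // exprM rmorphXn /= -natrX.
  rewrite ler_int; apply: le_trans (coef_sop_le _ _) _.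
  by rewrite wnormXn exprS ler_wpM2r ?exprn_ge0.
Qed.
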